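(* Let $k,r<n$ be positive integers and let $\lambda$ be a partition with $\lambda\le\Box_{k,n}$. Then in the quantum cohomology ring $qH^*(\mathrm{Gr}(k,n))$, \[ p_r * \sigma_\lambda \;=\; \sum_{\mu} (-1)^{\mathrm{ht}(\mu/\lambda)+1}\sigma_\mu \;-\; (-1)^k q\sum_{\nu}(-1)^{\mathrm{ht}(\lambda/\nu)+1}\sigma_\nu , \] where the first sum is over all partitions $\mu\le\Box_{k,n}$ such that $\mu/\lambda$ is a rim hook of size $r$, and the second sum is over all partitions $\nu\le\lambda$ such that $\lambda/\nu$ is a rim hook of size $n-r$.
   Context: Partitions are identified with their Young diagrams (left-justified rows of boxes, $\lambda_i$ boxes in row $i$). For partitions, $\lambda\le\mu$ means $\lambda_i\le\mu_i$ for all $i$, and $\mu/\lambda$ is the set difference of diagrams; its size is its number of boxes. $\Box_{k,n}$ is the partition with $k$ parts each equal to $n-k$, so $\lambda\le\Box_{k,n}$ means $\lambda$ has at most $k$ nonzero parts and $\lambda_1\le n-k$. A rim hook is a nonempty skew shape $\mu/\lambda$ whose boxes lie on a connected (consecutive) set of northwest-to-southeast diagonals with no two boxes on the same diagonal; its height $\mathrm{ht}(\mu/\lambda)$ is its number of rows. Let $\Lambda_k=\mathbb{Q}[x_1,\dots,x_k]^{S_k}$, with complete homogeneous symmetric polynomials $h_b$, Schur polynomials $s_\lambda=s_\lambda(x_1,\dots,x_k)$ and power sums $p_r=x_1^r+\dots+x_k^r$. The quantum cohomology ring of the Grassmannian is $qH^*(\mathrm{Gr}(k,n))=\Lambda_k[q]/\langle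 h_{n-k+1},\dotsc,h_{n-1},\,h_n+(-1)^kq\rangle$, where $q$ is an indeterminate (of degree $n$); its product is denoted $*$. For $\lambda\le\Box_{k,n}$, $\sigma_\lambda$ denotes the image of $s_\lambda$ in this ring (these form a $\mathbb{Q}[q]$-basis), and $p_r$ in the claim denotes the image of $p_r(x_1,\dots,x_k)$. *)

(* Defs.v *)
From HB Require Import structures.
From mathcomp Require Import all_boot all_order all_fingroup all_algebra.
From mathcomp Require Import boolp.
From mathcomp Require Import mpoly.

Set Implicit Arguments.
Unset Strict Implicit.
Unset Printing Implicit Defensive.

Import GRing.Theory.
Local Open Scope ring_scope.
Local Open Scope quotient_scope.

Lemma horner_prod_XsubC (R : comNzRingType) (I : finType) (a : I -> R) j :
  (\prod_i ('X - (a i)%:P)).[a j] = 0.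
Proof. by rewrite horner_prod (bigD1 j) //= hornerXsubC subrr mul0r. Qed.

(** * The ring of symmetric polynomials *)

Record sympoly (k : nat) :=
  SymPoly { sympoly_val :> {mpoly rat[k]}; _ : sympoly_val \is symmetric }.

HB.instance Definition _ k := [isSub for @sympoly_val k].
HB.instance Definition _ k := [Choice of sympoly k by <:].
HB.instance Definition _ k :=
  [SubChoice_isSubComNzRing of sympoly k by <:].
HB.instance Definition _ k := GRing.RMorphism.copy (@sympoly_val k)
  (\val : sympoly k -> {mpoly rat[k]}).

Section SymmetricPolynomials.
Variable k : nat.

Definition complete_poly (b : nat) : {mpoly rat[k]} :=
  \sum_(m : 'X_{1..k < b.+1} | mdeg m == b) 'X_[m].

Definition power_poly (r : nat) : {mpoly rat[k]} := \sum_(i < k) 'X_i ^+ r.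

Lemma complete_poly_coeff b m : (complete_poly b)@_m = (mdeg m == b)%:R.
Proof.
rewrite /complete_poly raddf_sum /=.
have [mb|nmb] := eqVneq (mdeg m) b; last first.
  apply: big1 => m' /eqP m'b; rewrite mcoeffX; case: eqP => // mm'.
  by rewrite -mm' m'b eqxx in nmb.
have lt_m : (mdeg m < b.+1)%N by rewrite mb.
rewrite (bigD1 (BMultinom lt_m)) /= ?mb // mcoeffX eqxx big1 ?addr0 //.
by move=> m' /andP[_ ne]; rewrite mcoeffX; case: eqP => // e; case/eqP: ne; apply: val_inj.
Qed.

Lemma complete_poly_sym b : complete_poly b \is symmetric.
Proof.
apply/issymP => s; apply/mpolyP => m.
by rewrite mcoeff_sym !complete_poly_coeff mdeg_mperm.
Qed.

Lemma msymXi (s : 'S_k) (i : 'I_k) : msym s 'X_i = 'X_(s i) :> {mpoly rat[k]}.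
Proof.
rewrite msymX; congr 'X_[_]; apply/mnmP => j; rewrite mnmE !mnm1E.
by congr nat_of_bool; apply/eqP/eqP => [->|<-]; rewrite ?permKV ?permK.
Qed.

Lemma power_poly_sym r : power_poly r \is symmetric.
Proof.
apply/issymP => s; rewrite /power_poly raddf_sum /= [RHS](reindex_perm s) /=.
by apply: eq_bigr => i _; rewrite rmorphXn /= msymXi.
Qed.

Definition complete b : sympoly k := SymPoly (complete_poly_sym b).
Definition power_sum r : sympoly k := SymPoly (power_poly_sym r).

(** Schur polynomials are the ratios [a_(lam + delta) / a_delta] of alternants,
    with [delta = (k - 1, ..., 1, 0)]; the ratio is unique because the
    Vandermonde determinant [a_delta] is nonzero. *)

Definition alternant (a : 'I_k -> nat) : {mpoly rat[k]} :=
  \det (\matrix_(i < k, j < k) 'X_i ^+ a j).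

Definition delta (j : 'I_k) : nat := (k - j.+1)%N.

Let root_poly : {poly {mpoly rat[k]}} := \prod_(i < k) ('X - ('X_i)%:P).

Let root_poly_sym i : root_poly`_i \is symmetric.
Proof.
apply/issymP => s; rewrite -coef_map; congr (polyseq _)`_i.
rewrite /root_poly rmorph_prod /= [RHS](reindex_perm s) /=.
by apply: eq_bigr => j _; rewrite rmorphB /= map_polyX map_polyC /= msymXi.
Qed.

Let size_root_poly : size root_poly = k.+1.
Proof. by rewrite size_prod_XsubC /index_enum -enumT size_enum_ord. Qed.

Let sym_root_poly : {poly sympoly k} :=
  \poly_(i < k.+1) SymPoly (root_poly_sym i).

Let map_sym_root_poly : map_poly val sym_root_poly = root_poly.
Proof.
apply/polyP => i; rewrite coef_map coef_poly /=.
by case: ltnP => //= le_ki; rewrite nth_default // size_root_poly.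
Qed.

Let size_sym_root_poly : size sym_root_poly = k.+1.
Proof.
by rewrite -size_root_poly -map_sym_root_poly (size_map_inj_poly val_inj).
Qed.

Let sym_root_poly_monic : sym_root_poly \is monic.
Proof.
apply/monicP/val_inj; rewrite -(lead_coef_map_inj val_inj) // map_sym_root_poly.
exact/monicP/monic_prod_XsubC.
Qed.

Let power_reduction (m : nat) : exists c : 'I_k -> sympoly k,
  forall j : 'I_k, 'X_j ^+ m = \sum_(i < k) val (c i) * 'X_j ^+ i.
Proof.
pose r := Pdiv.CommonRing.rmodp 'X^m sym_root_poly.
exists (fun i => r`_i) => j.
have size_r : (size (map_poly val r) <= k)%N.
  rewrite (size_map_inj_poly val_inj) // -ltnS -size_sym_root_poly.
  by rewrite Pdiv.Ring.ltn_rmodp monic_neq0.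
have /(congr1 (map_poly val)) := Pdiv.RingMonic.rdivp_eq sym_root_poly_monic 'X^m.
rewrite rmorphD rmorphM /= map_sym_root_poly map_polyXn -/r.
move/(congr1 (fun p => p.['X_j])); rewrite hornerD hornerM hornerXn => ->.
have -> : root_poly.['X_j] = 0.
  exact: (horner_prod_XsubC (fun i : 'I_k => 'X_i)).
rewrite mulr0 add0r (horner_coef_wide _ size_r).
by apply: eq_bigr => i _; rewrite coef_map.
Qed.

Lemma schur_exists (lam : 'I_k -> nat) : exists s : sympoly k,
  val s * alternant delta == alternant (fun j => lam j + delta j)%N.
Proof.
pose c j := projT1 (cid (power_reduction (lam j + delta j))).
have cE j : forall i : 'I_k,
    'X_i ^+ (lam j + delta j) = \sum_(l < k) val (c j l) * 'X_i ^+ l.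
  exact: projT2 (cid (power_reduction (lam j + delta j))).
exists (\det (\matrix_(l, j) c j (rev_ord l))); apply/eqP.
rewrite mulrC -det_map_mx -det_mulmx; congr (\det _).
apply/matrixP => i j; rewrite !mxE cE [RHS](reindex_inj rev_ord_inj) /=.
by apply: eq_bigr => l _; rewrite !mxE mulrC.
Qed.

Definition schur (lam : 'I_k -> nat) : sympoly k := xchoose (schur_exists lam).

Lemma schurE lam :
  val (schur lam) * alternant delta = alternant (fun j => lam j + delta j)%N.
Proof. exact/eqP/(xchooseP (schur_exists lam)). Qed.

End SymmetricPolynomials.

(** * The quantum cohomology ring of the Grassmannian *)

Definition ideal_gen (R : comNzRingType) (gs : seq R) : pred R :=
  fun x => `[< exists c : nat -> R, x = \sum_(i < size gs) c i * gs`_i >].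

(** The polynomial variable ['X] of [{poly sympoly k}] is the indeterminate
    [q]; the first family of relations is [h_(n-k+1), ..., h_(n-1)]. *)
Definition qH_relations (k n : nat) : seq {poly sympoly k} :=
  rcons [seq (complete k b)%:P | b <- index_iota (n - k).+1 n]
        ((complete k n)%:P + (-1) ^+ k * 'X).

Definition qH_ideal (k n : nat) : pred {poly sympoly k} :=
  ideal_gen (qH_relations k n).
Arguments qH_ideal : clear implicits.

Lemma qH_ideal_closed k n : idealr_closed (qH_ideal k n).
Proof.
split.
- by apply/asboolP; exists (fun=> 0); rewrite big1 // => i _; rewrite mul0r.
- apply/negP => /asboolP [c].
  pose t : sympoly k := - ((-1) ^+ k * (n == 0%N)%:R).
  pose ev : {rmorphism {poly sympoly k} -> rat} :=
    (mcoeff 0%MM \o @sympoly_val k) \o horner_eval t.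
  have evC f : ev f%:P = (sympoly_val f)@_0%MM.
    by rewrite /= /horner_eval hornerC.
  have evX : ev 'X = - ((-1) ^+ k * (n == 0%N)%:R).
    have tE (phi : {rmorphism sympoly k -> rat}) :
        phi t = - ((-1) ^+ k * (n == 0%N)%:R).
      by rewrite rmorphN rmorphM rmorphXn rmorphN1 rmorph_nat.
    rewrite /= /horner_eval hornerX.
    exact: (tE (mcoeff 0%MM \o @sympoly_val k)).
  move/(congr1 ev); rewrite rmorph1 rmorph_sum big1 => [/eqP|i _].
    by rewrite oner_eq0.
  rewrite rmorphM.
  have : (qH_relations k n)`_i \in qH_relations k n by exact: mem_nth.
  rewrite mem_rcons inE => /predU1P[->|/mapP[b]].
    rewrite rmorphD rmorphM evC evX complete_poly_coeff mdeg0.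
    rewrite (rmorphXn ev) rmorphN1 mulrN mulrA -expr2 sqrr_sign mul1r eq_sym.
    by rewrite subrr mulr0.
  rewrite mem_index_iota => /andP[lt_b _] ->.
  by rewrite evC complete_poly_coeff mdeg0; case: b lt_b => //= b _; rewrite mulr0.
- move=> a u v /asboolP[c ->] /asboolP[d ->]; apply/asboolP.
  exists (fun i => a * c i + d i); rewrite mulr_sumr -big_split /=.
  by apply: eq_bigr => i _; rewrite mulrDl mulrA.
Qed.

HB.instance Definition _ k n :=
  isIdealr.Build {poly sympoly k} (qH_ideal k n) (qH_ideal_closed k n).

Definition qH_idealr (k n : nat) : idealr {poly sympoly k} :=
  Idealr.clone {poly sympoly k} (qH_ideal k n) _.

Definition qH (k n : nat) : comNzRingType := {ideal_quot (qH_idealr k n)}.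

Section QuantumClasses.
Variables k n : nat.

Definition qH_class (f : {poly sympoly k}) : qH k n :=
  \pi_{ideal_quot (qH_idealr k n)} f.

(** Partitions contained in the [k * (n - k)] rectangle, padded with zeros to
    exactly [k] parts. Rows and columns are numbered from 0. *)
Record box_partition := BoxPartition {
  part :> {ffun 'I_k -> 'I_(n - k).+1};
  _ : [forall i : 'I_k, forall j : 'I_k, (i <= j) ==> (part j <= part i)]%N }.

HB.instance Definition _ := [isSub for part].
HB.instance Definition _ := [Finite of box_partition by <:].

Implicit Types lam mu : box_partition.

Definition sigma lam : qH k n := qH_class (schur (fun i => lam i : nat))%:P.
Definition quantum_power_sum (r : nat) : qH k n := qH_class (power_sum k r)%:P.
Definition quantum_param : qH k n := qH_class 'X.

Definition part_le lam mu : bool := [forall i, lam i <= mu i]%N.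

Definition diagram lam : {set 'I_k * 'I_(n - k)} :=
  [set b : 'I_k * 'I_(n - k) | b.2 < lam b.1]%N.

Definition skew_shape mu lam : {set 'I_k * 'I_(n - k)} := diagram mu :\: diagram lam.

(** Number of the northwest-to-southeast diagonal of a box: this is its content
    (column minus row) shifted by [k - 1], and is less than [n]. *)
Definition diagonal (b : 'I_k * 'I_(n - k)) : nat := (b.2 + (k - b.1.+1))%N.

Definition is_rim_hook mu lam : bool :=
  [&& part_le lam mu, skew_shape mu lam != set0,
      [forall b in skew_shape mu lam, forall b' in skew_shape mu lam,
         (diagonal b == diagonal b') ==> (b == b')]
    & [forall b in skew_shape mu lam, forall b' in skew_shape mu lam, forall d : 'I_n,
         (diagonal b <= d <= diagonal b')%N ==>
         [exists b'' in skew_shape mu lam, diagonal b'' == d]]].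

Definition height mu lam : nat := #|[set b.1 | b in skew_shape mu lam]|.

End QuantumClasses.
Arguments qH_class : clear implicits.

(* Main.v *)
(** The idea is to work with exponent vectors [b = lam + delta] and the ratios
    [S(b)] of the alternant of [b] by that of [delta]; [S] is alternating in [b].
    Multiplying by [p_r] raises one exponent by [r], so
    [p_r * S(b) = \sum_j S(b + r e_j)].  In the polynomial ring [x_i^n] is a
    combination of [h_(n-k+1), ..., h_n] whose [h_n]-coefficient is [1]; modulo
    the relations this says [x_i^n = - (-1)^k q], so an exponent that reached [n]
    may be lowered by [n] at the cost of the factor [- (-1)^k q].  Finally, sorting
    a strictly decreasing vector after changing one entry by [t] either hits a
    repeated entry (giving [0]) or, up to the sign of a cycle, gives the vector of
    the partition obtained by adding or removing a rim hook of size [t]. *)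

From HB Require Import structures.
Require Import Defs.
From mathcomp Require Import all_boot all_order all_fingroup all_algebra.
From mathcomp Require Import boolp mpoly zify ring.
Import GRing.Theory.
Local Open Scope ring_scope.
Local Open Scope quotient_scope.
Set Implicit Arguments.
Unset Strict Implicit.
Unset Printing Implicit Defensive.

(** * Alternants and the Jacobi-Trudi formula *)

Section Alternants.
Variable k : nat.
Implicit Types (b c : 'I_k -> nat) (i j : 'I_k) (m : nat).

Definition replace c j v i : nat := if i == j then v else c i.

Definition alternant_mx c : 'M[{mpoly rat[k]}]_k := \matrix_(i, j) 'X_i ^+ c j.

Lemma eq_alternant b c : b =1 c -> alternant b = alternant c.
Proof. by move=> bc; congr (\det _); apply/matrixP => i j; rewrite !mxE bc. Qed.

Lemma alternant_perm (s : 'S_k) c :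
  alternant (fun j => c (s j)) = (-1) ^+ s * alternant c.
Proof.
rewrite -odd_permV -det_perm mulrC -det_mulmx -col_permE.
by congr (\det _); apply/matrixP => i j; rewrite !mxE.
Qed.

Lemma alternant_eq0 c i j : i != j -> c i = c j -> alternant c = 0.
Proof.
move=> neq_ij cij; rewrite /alternant -det_tr.
by apply: (determinant_alternate neq_ij) => l; rewrite !mxE cij.
Qed.

(** Reversing the columns gives, up to sign, a Vandermonde determinant: a product of differences of
    distinct variables. *)
Lemma alternant_delta_neq0 : alternant (@delta k) != 0.
Proof.
have -> : alternant (@delta k) =
    (-1) ^+ perm (@rev_ord_inj k) * alternant (@nat_of_ord k).
  by rewrite -alternant_perm; apply: eq_alternant => j; rewrite permE.
rewrite mulf_eq0 signr_eq0 /=.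
have -> : alternant (@nat_of_ord k) =
    \det (Vandermonde k (\row_i 'X_i : 'rV[{mpoly rat[k]}]_k)).
  by rewrite -det_tr; congr (\det _); apply/matrixP => i j; rewrite !mxE.
rewrite det_Vandermonde; apply/prodf_neq0 => i _; apply/prodf_neq0 => j lt_ij.
rewrite !mxE subr_eq0; apply/eqP => /(congr1 (mcoeff U_(i)%MM)).
rewrite !mcoeffXU eqxx; case: eqP => [ji|_ /eqP]; last by rewrite eq_sym oner_eq0.
by rewrite ji ltnn in lt_ij.
Qed.

(** Only column [j] sees [v], so the alternant is linear in the powers ['X_i ^+ v], and identities
    between powers of single variables carry over to it. *)
Lemma alternant_replace c j v :
  alternant (replace c j v) = \sum_i 'X_i ^+ v * cofactor (alternant_mx c) i j.
Proof.
rewrite /alternant (expand_det_col _ j); apply: eq_bigr => i _.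
rewrite mxE /replace eqxx; congr (_ * (_ * \det _)).
by apply/matrixP => u w; rewrite !mxE eq_sym (negbTE (neq_lift _ _)).
Qed.

(** Both sides are the double sum of ['X_i ^+ (c j + r)] times the cofactor at [(i, j)], grouped by
    rows on the left and by columns on the right. *)
Lemma power_poly_alternant r c :
  power_poly k r * alternant c = \sum_j alternant (replace c j (c j + r)%N).
Proof.
under [RHS]eq_bigr do rewrite alternant_replace.
rewrite exchange_big mulr_suml /=; apply: eq_bigr => i _.
rewrite [alternant c](expand_det_row _ i) mulr_sumr; apply: eq_bigr => j _.
by rewrite mxE addnC exprD mulrA.
Qed.

(** Generating function of the signed elementary symmetric polynomials [(-1)^s e_s]. *)
Definition elem_gen : {poly {mpoly rat[k]}} := \prod_i (1 - ('X_i)%:P * 'X).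

Definition elem_gen_omit i : {poly {mpoly rat[k]}} :=
  \prod_(j | j != i) (1 - ('X_j)%:P * 'X).

Lemma elem_genE i : elem_gen = elem_gen_omit i * (1 - ('X_i)%:P * 'X).
Proof. by rewrite /elem_gen (bigD1 i) //= mulrC. Qed.

Lemma elem_gen_sym s : elem_gen`_s \is symmetric.
Proof.
apply/issymP => t; rewrite -coef_map; congr (polyseq _)`_s.
rewrite /elem_gen rmorph_prod /= [RHS](reindex_perm t) /=.
apply: eq_bigr => j _.
by rewrite rmorphB rmorphM /= rmorph1 map_polyX map_polyC /= msymXi.
Qed.

Lemma size_elem_gen_omit i : (size (elem_gen_omit i) <= k)%N.
Proof.
apply: leq_trans (size_poly_prod_leq _ _) _.
have -> : #|[pred j | j != i]| = k.-1 by rewrite cardC1 card_ord.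
have k_gt0 : (0 < k)%N by case: k i => [[]|].
rewrite leq_subLR -[leqRHS]/(k.-1 + k)%N.
have : (\sum_(j | j != i) size (1 - ('X_j)%:P * 'X : {poly {mpoly rat[k]}})%R
        <= \sum_(j : 'I_k | j != i) 2)%N.
  apply: leq_sum => j _; apply: leq_trans (size_polyD _ _) _.
  rewrite size_polyN size_poly1 geq_max /=.
  apply: leq_trans (size_polyMleq _ _) _.
  by rewrite size_polyX addn2 ltnS size_polyC_leq1.
rewrite sum_nat_const cardC1 card_ord => /leq_ltn_trans; apply.
by rewrite muln2 -addnn ltn_add2l prednK.
Qed.

(** Geometric series truncated at degree [m] to remain polynomials; up to that degree the product is
    the generating function of the complete symmetric polynomials. *)
Definition complete_gen m : {poly {mpoly rat[k]}} :=
  \prod_i \poly_(a < m.+1) 'X_i ^+ a.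

Lemma coef_complete_gen m a : (a <= m)%N -> (complete_gen m)`_a = complete_poly k a.
Proof.
move=> le_am; rewrite /complete_gen.
under eq_bigr do rewrite poly_def.
rewrite bigA_distr_bigA /= coef_sum; apply/mpolyP => u.
rewrite complete_poly_coeff raddf_sum /=.
have prodE (f : {ffun 'I_k -> 'I_m.+1}) :
    \prod_i (('X_i : {mpoly rat[k]}) ^+ f i *: 'X^(f i)) =
    'X_[ [multinom (f i : nat) | i < k] ] *: 'X^(\sum_i f i).
  rewrite scaler_prod -expr_sum mpolyXE_id; congr (_ *: _).
  by apply: eq_bigr => i _; rewrite mnmE.
under eq_bigr do rewrite prodE coefZ coefXn mulr_natr mcoeffMn mcoeffX.
have [du|ndu] := eqVneq (mdeg u) a; last first.
  apply: big1 => f _; case: eqP => [fu|]; rewrite ?mul0rn //.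
  case: eqP => // af; case/eqP: ndu; rewrite -fu mdegE af.
  by apply: eq_bigr => i _; rewrite mnmE.
have ltu i : (u i < m.+1)%N.
  by rewrite ltnS (leq_trans _ le_am) // -du mdegE (bigD1 i) //= leq_addr.
pose f0 := [ffun i => Ordinal (ltu i)].
have f0E : [multinom (f0 i : nat) | i < k] = u by apply/mnmP => i; rewrite mnmE ffunE.
rewrite (bigD1 f0) //= f0E eqxx -du mdegE.
have -> : (\sum_i u i = \sum_i f0 i)%N by apply: eq_bigr => i _; rewrite ffunE.
rewrite eqxx big1 ?addr0 // => f nf; case: eqP => [fu|]; rewrite ?mul0rn //; case/eqP: nf.
by apply/ffunP => i; apply: val_inj; rewrite ffunE /= -fu mnmE.
Qed.


(** With [t] for ['X], the factors pair to [1 - (x_i t)^(m+1)], and polynomials congruent to 1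
    modulo [t^(m+1)] are closed under products. *)
Lemma coef_elem_complete_gen m a : (a <= m)%N ->
  (elem_gen * complete_gen m)`_a = (a == 0%N)%:R.
Proof.
move=> le_am.
have [Q ->] : exists Q, elem_gen * complete_gen m = 1 + 'X^(m.+1) * Q.
  rewrite /elem_gen /complete_gen -big_split /=.
  apply: (big_ind (fun P : {poly {mpoly rat[k]}} => exists Q, P = 1 + 'X^(m.+1) * Q)).
  - by exists 0; rewrite mulr0 addr0.
  - move=> _ _ [Q ->] [Q' ->]; exists (Q + Q' + 'X^(m.+1) * Q * Q').
    by ring.
  move=> i _; exists (- (('X_i) ^+ m.+1)%:P).
  have -> : \poly_(a' < m.+1) ('X_i : {mpoly rat[k]}) ^+ a' =
      \sum_(a' < m.+1) (('X_i)%:P * 'X) ^+ a'.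
    rewrite poly_def; apply: eq_bigr => a' _.
    by rewrite exprMn -polyC_exp mul_polyC.
  rewrite -[1 - ('X_i)%:P * 'X]opprB mulNr -subrX1 opprB exprMn -polyC_exp.
  by rewrite mulrN [in RHS]mulrC.
by rewrite coefD coef1 coefXnM ltnS le_am addr0.
Qed.

(** Without the factor of [x_i], the product is the geometric series [1 / (1 - x_i t)] up to degree
    [m]; restoring the factor yields the recursion behind the induction. *)
Lemma coef_elem_gen_omit_complete_gen i m a : (a <= m)%N ->
  (elem_gen_omit i * complete_gen m)`_a = 'X_i ^+ a.
Proof.
elim: a => [|a IH] le_am; have := coef_elem_complete_gen le_am;
  rewrite (elem_genE i) mulrAC mulrBr mulr1 coefB mulrA coefMX /= ?subr0 //.
rewrite coefMC IH 1?ltnW // -exprSr => /eqP.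
by rewrite subr_eq0 => /eqP.
Qed.

(* [h_(m - s)] with [h_b = 0] for [b < 0]; truncated subtraction would give [h_0 = 1]. *)
Definition complete_sub m s : sympoly k := if (s <= m)%N then complete k (m - s) else 0.

Lemma powerX_complete i m :
  'X_i ^+ m = \sum_(l < k) (elem_gen_omit i)`_l * val (complete_sub m l).
Proof.
rewrite -(coef_elem_gen_omit_complete_gen i (leqnn m)) coefM.
pose F l := (elem_gen_omit i)`_l * val (complete_sub m l).
have -> : \sum_(j < m.+1) (elem_gen_omit i)`_j * (complete_gen m)`_(m - j) =
    \sum_(j < m.+1) F j.
  apply: eq_bigr => j _; rewrite coef_complete_gen ?leq_subr // /F /complete_sub.
  by rewrite -ltnS ltn_ord.
(* Both sums extend to the common length [k + m.+1]: the coefficients vanish from [k] on, and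
   [complete_sub] vanishes above [m]. *)
have tail N : (N <= k + m.+1)%N -> (forall j : nat, (N <= j)%N -> F j = 0) ->
    \sum_(j < N) F j = \sum_(j < k + m.+1) F j.
  move=> le_N F0; rewrite (big_ord_widen _ F le_N) big_mkcond /=.
  by apply: eq_bigr => j _; case: ltnP => // /F0 ->.
rewrite (tail _ (leq_addl _ _)) ?(tail _ (leq_addr _ _)) // => j le_j.
  by rewrite /F nth_default ?mul0r // (leq_trans (size_elem_gen_omit i)).
by rewrite /F /complete_sub leqNgt le_j rmorph0 mulr0.
Qed.

(** Dividing by [1 - x_i t] writes the coefficient as a polynomial in [x_i] whose coefficients are
    symmetric and independent of [i]. *)
Lemma coef_elem_gen_omit i s :
  (elem_gen_omit i)`_s = \sum_(u < s.+1) elem_gen`_u * 'X_i ^+ (s - u).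
Proof.
elim: s => [|s IH].
  by rewrite big_ord1 mulr1 (elem_genE i) mulrBr mulr1 coefB mulrA coefMX subr0.
rewrite big_ord_recr /= subnn mulr1 {2}(elem_genE i) mulrBr mulr1 coefB mulrA coefMX /=.
rewrite coefMC mulrC IH mulr_sumr.
rewrite [X in X + _](eq_bigr (fun u : 'I_s.+1 => 'X_i * (elem_gen`_u * 'X_i ^+ (s - u)))).
  by rewrite addrC subrK.
by move=> u _; rewrite subSn -1?ltnS // exprS mulrCA.
Qed.

(** For [b = lam + delta] the entries are [h_(lam_j - j + l)]; arbitrary [b] are allowed so that
    unsorted exponent vectors also have a ratio [S(b)]. *)
Definition jacobi_trudi b : sympoly k :=
  \det (\matrix_(l, j) complete_sub (b j) (delta l)).

(** [powerX_complete] factors the alternant matrix as a matrix [G] independent of [b] times the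
    Jacobi-Trudi matrix, which is unitriangular for [b = delta]; hence [\det G] is the alternant of
    [delta]. *)
Lemma jacobi_trudiE b : val (jacobi_trudi b) * alternant (@delta k) = alternant b.
Proof.
pose G : 'M[{mpoly rat[k]}]_k := \matrix_(i, l) (elem_gen_omit i)`_(delta l).
have E c : alternant c = \det G * val (jacobi_trudi c).
  rewrite /jacobi_trudi -det_map_mx -det_mulmx; congr (\det _).
  apply/matrixP => i j; rewrite !mxE powerX_complete (reindex_inj rev_ord_inj) /=.
  by apply: eq_bigr => l _; rewrite !mxE.
rewrite (E (@delta k)) (E b) mulrCA; congr (_ * _).
suff -> : jacobi_trudi (@delta k) = 1 by rewrite rmorph1 mulr1.
rewrite /jacobi_trudi det_trig.
  apply: big1 => i _; rewrite mxE /complete_sub leqnn subnn.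
  apply/val_inj/mpolyP => u; rewrite complete_poly_coeff rmorph1 mcoeff1.
  by rewrite mdeg_eq0.
apply/is_trig_mxP => i j lt_ij; rewrite mxE /complete_sub; case: leqP => //.
by have := ltn_ord j; rewrite /delta; lia.
Qed.

Lemma sympoly_alternant_inj (f g : sympoly k) :
  val f * alternant (@delta k) = val g * alternant (@delta k) -> f = g.
Proof. by move=> fg; apply/val_inj/(mulIf alternant_delta_neq0). Qed.

Lemma schur_jacobi_trudi (lam : 'I_k -> nat) :
  schur lam = jacobi_trudi (fun j => lam j + delta j)%N.
Proof. by apply: sympoly_alternant_inj; rewrite schurE jacobi_trudiE. Qed.

Lemma jacobi_trudi_perm (s : 'S_k) c :
  jacobi_trudi (fun j => c (s j)) = (-1) ^+ s * jacobi_trudi c.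
Proof.
apply: sympoly_alternant_inj; rewrite rmorphM rmorph_sign -mulrA !jacobi_trudiE.
exact: alternant_perm.
Qed.

Lemma eq_jacobi_trudi b c : b =1 c -> jacobi_trudi b = jacobi_trudi c.
Proof. by move=> bc; congr (\det _); apply/matrixP => i j; rewrite !mxE bc. Qed.

Lemma jacobi_trudi_eq0 c i j : i != j -> c i = c j -> jacobi_trudi c = 0.
Proof.
move=> neq_ij cij; apply: sympoly_alternant_inj.
by rewrite jacobi_trudiE (alternant_eq0 neq_ij cij) rmorph0 mul0r.
Qed.

Lemma power_sum_jacobi_trudi r c :
  power_sum k r * jacobi_trudi c = \sum_j jacobi_trudi (replace c j (c j + r)).
Proof.
apply: sympoly_alternant_inj; rewrite rmorphM -mulrA jacobi_trudiE.
rewrite -[LHS]/(power_poly k r * alternant c) power_poly_alternant.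
rewrite rmorph_sum mulr_suml.
by apply: eq_bigr => j _; exact/esym/jacobi_trudiE.
Qed.

Definition elem_sym u : sympoly k := SymPoly (elem_gen_sym u).

(** In column [j], expand ['X_i ^+ n] by [powerX_complete] and its coefficients by
    [coef_elem_gen_omit]; the symmetric factors then leave the sum over [i]. *)
Lemma jacobi_trudi_reduction c j v n :
  jacobi_trudi (replace c j (v + n)) =
  \sum_(l < k) complete_sub n l *
    \sum_(u < l.+1) elem_sym u * jacobi_trudi (replace c j (v + (l - u))).
Proof.
apply: sympoly_alternant_inj; rewrite jacobi_trudiE alternant_replace.
rewrite rmorph_sum mulr_suml.
transitivity (\sum_i \sum_(l < k) val (complete_sub n l) *
   (\sum_(u < l.+1) val (elem_sym u) *
      ('X_i ^+ (v + (l - u))%N * cofactor (alternant_mx c) i j))).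
  apply: eq_bigr => i _; rewrite exprD (powerX_complete i n) mulr_sumr mulr_suml.
  apply: eq_bigr => l _; rewrite coef_elem_gen_omit.
  rewrite mulr_suml mulr_sumr mulr_suml mulr_sumr.
  apply: eq_bigr => u _; rewrite exprD /=; ring.
rewrite exchange_big; apply: eq_bigr => l _.
rewrite -mulr_sumr rmorphM -mulrA; congr (_ * _).
rewrite exchange_big rmorph_sum mulr_suml; apply: eq_bigr => u _.
by rewrite -mulr_sumr rmorphM -mulrA jacobi_trudiE alternant_replace.
Qed.

End Alternants.

(** * Lowering an exponent by [n] in the quantum ring *)

Section QuantumReduction.
Variables k n : nat.
Implicit Types (f g : sympoly k) (c : 'I_k -> nat).

HB.instance Definition _ := GRing.RMorphism.copy (qH_class k n)
  (\pi_({ideal_quot (qH_idealr k n)}) : {poly sympoly k} -> qH k n).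

Definition sym_class f : qH k n := qH_class k n f%:P.

HB.instance Definition _ := GRing.RMorphism.copy sym_class (qH_class k n \o polyC).

Lemma qH_class_relation (g : {poly sympoly k}) :
  g \in qH_relations k n -> qH_class k n g = 0.
Proof.
move=> /(nthP 0) [i lt_i <-]; rewrite -[RHS](rmorph0 (qH_class k n)).
apply/eqP; rewrite -[_ == _]Quotient.idealrBE subr0; apply/asboolP.
exists (fun j => (j == i)%:R); rewrite (bigD1 (Ordinal lt_i)) //= eqxx mul1r.
by rewrite big1 ?addr0 // => j; rewrite -val_eqE /= => /negbTE ->; rewrite mul0r.
Qed.

Lemma sym_class_complete b : (n - k < b < n)%N -> sym_class (complete k b) = 0.
Proof.
move=> b_range; apply: qH_class_relation; rewrite mem_rcons inE; apply/orP; right.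
by apply/mapP; exists b; rewrite ?mem_index_iota.
Qed.

Lemma sym_class_complete_n :
  sym_class (complete k n) = - ((-1) ^+ k * quantum_param k n).
Proof.
have /eqP : qH_class k n ((complete k n)%:P + (-1) ^+ k * 'X) = 0.
  by apply: qH_class_relation; rewrite mem_rcons mem_head.
by rewrite rmorphD rmorphM rmorph_sign addr_eq0 => /eqP.
Qed.

(** For [0 < l < k] the factor [h_(n - l)] is a relation, so only [l = 0] survives; it contributes
    [h_n] times [e_0 = 1]. *)
Lemma jacobi_trudi_quantum_reduction c j v : (k <= n)%N ->
  sym_class (jacobi_trudi (replace c j (v + n))) =
  - ((-1) ^+ k * quantum_param k n) * sym_class (jacobi_trudi (replace c j v)).
Proof.
move=> le_kn; have k_gt0 : (0 < k)%N by case: k j => [[]|].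
rewrite jacobi_trudi_reduction rmorph_sum (bigD1 (Ordinal k_gt0)) //=.
rewrite [X in _ + X]big1 ?addr0 => [|l /= nz_l]; last first.
  have lt_lk := ltn_ord l; have l_gt0 : (0 < l)%N by rewrite lt0n.
  rewrite rmorphM /= {1}/complete_sub ifT; last by lia.
  by rewrite sym_class_complete ?mul0r //; lia.
rewrite big_ord1 /= subn0 addn0 !rmorphM /= {1}/complete_sub leq0n subn0.
rewrite sym_class_complete_n; congr (_ * _).
suff -> : elem_sym k 0 = 1 by rewrite rmorph1 mul1r.
apply: val_inj; rewrite rmorph1 /= /elem_gen -horner_coef0 horner_prod big1 // => i _.
by rewrite hornerD hornerN hornerM hornerX mulr0 subr0 hornerE.
Qed.

End QuantumReduction.

(** * Rim hooks and strictly decreasing sequences *)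

Lemma card_ord_interval N a b : (b <= N)%N ->
  #|[set c : 'I_N | a <= c < b]%N| = (b - a)%N.
Proof.
move=> le_bN; rewrite cardsE -sum1_card -(big_mkord (fun c => a <= c < b)%N (fun=> 1%N)).
rewrite -[RHS]muln1 -sum_nat_const_nat (big_nat_widenl a 0) //.
rewrite (big_nat_widen _ _ _ _ _ le_bN).
by apply: eq_bigl.
Qed.

Section StrictlyDecreasing.
Local Open Scope nat_scope.
Variable k : nat.
Implicit Types (a b : 'I_k.+1 -> nat) (i j p l : 'I_k.+1).

Definition decreasing m (a : 'I_m -> nat) := forall i j : 'I_m, i < j -> a j < a i.

Lemma decreasing_leq m (a : 'I_m -> nat) (i j : 'I_m) :
  decreasing a -> i <= j -> a j <= a i.
Proof.
move=> decr_a; rewrite leq_eqVlt => /predU1P[/val_inj->//|/decr_a].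
exact: ltnW.
Qed.

Lemma decreasing_ltn m (a : 'I_m -> nat) (i j : 'I_m) :
  decreasing a -> (a j < a i) = (i < j).
Proof.
move=> decr_a; apply/idP/idP => [|/decr_a //].
by rewrite ltnNge [i < j]ltnNge; apply: contra => /(decreasing_leq decr_a).
Qed.

Lemma decreasing_inj m (a : 'I_m -> nat) : decreasing a -> injective a.
Proof.
move=> decr_a i j aij; case: (ltngtP i j) => [/decr_a|/decr_a|/val_inj //];
  by rewrite aij ltnn.
Qed.

Lemma decreasing_gap m (a : 'I_m -> nat) (i j : 'I_m) :
  decreasing a -> i <= j -> a j + (j - i) <= a i.
Proof.
move=> decr_a; move: {2}(j - i) (erefl (j - i)) => d.
elim: d j => [|d IH] j dE le_ij.
  by rewrite dE addn0 (decreasing_leq decr_a).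
have lt_jm : j.-1 < m by have := ltn_ord j; lia.
have /(decr_a (Ordinal lt_jm)) : j.-1 < j by lia.
have /= := IH (Ordinal lt_jm); lia.
Qed.

(* The diagonals met in row [i] by a skew shape whose shifted row lengths are
    [a] (inner) and [b] (outer). *)
Definition on_row m (a b : 'I_m -> nat) (i : 'I_m) d := a i <= d < b i.

(** Boxes of one row lie on different diagonals anyway, so this says that no diagonal carries two
    boxes. *)
Definition disjoint_rows m (a b : 'I_m -> nat) := forall (i j : 'I_m) d,
  on_row a b i d -> on_row a b j d -> i = j.

Definition convex_rows m (a b : 'I_m -> nat) := forall (i j : 'I_m) d e f,
  on_row a b i d -> on_row a b j f -> d <= e <= f -> exists h : 'I_m, on_row a b h e.

(** Let [p] and [l] be the first and last rows where [a] and [b] differ. Between them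
    [b_(i+1) = a_i]: a larger [b_(i+1)] puts diagonal [a_i] in two rows, a smaller one leaves
    diagonal [a_i - 1] uncovered. *)
Lemma hook_delete a b : decreasing a -> decreasing b ->
  (forall i, a i <= b i) -> (exists i, a i < b i) ->
  disjoint_rows a b -> convex_rows a b ->
  exists p l, forall x : 'I_k, b (lift p x) = a (lift l x).
Proof.
move=> decr_a decr_b le_ab [i0 ab_i0] disj conv.
case: (arg_minnP (P := fun i => a i < b i) (@nat_of_ord _) ab_i0) => p ab_p p_min.
case: (arg_maxnP (P := fun i => a i < b i) (@nat_of_ord _) ab_i0) => l ab_l l_max.
exists p, l => x.
have out i : (i < p) || (l < i) -> b i = a i.
  move=> i_out; apply/eqP; rewrite eqn_leq le_ab andbT leqNgt.
  by apply/negP => abi; have := p_min _ abi; have /= := l_max _ abi; lia.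
have := p_min _ ab_l; rewrite /= => le_pl.
have [lt_xp|le_px] := ltnP x p.
  rewrite out; last by rewrite /= /bump; lia.
  by congr a; apply: val_inj; rewrite /= /bump; lia.
have [lt_xl|le_lx] := ltnP x l; last first.
  rewrite out; last by rewrite /= /bump; lia.
  by congr a; apply: val_inj; rewrite /= /bump; lia.
have iE : lift l x = x :> nat by rewrite /= /bump; lia.
have jE : lift p x = x.+1 :> nat by rewrite /= /bump; lia.
move: (lift l x) (lift p x) iE jE => i j iE jE.
have le_aibp : a i <= b p.
  by apply: leq_trans (le_ab i) _; apply: (decreasing_leq decr_b); rewrite iE.
have lt_alai : a l < a i by apply: decr_a; rewrite iE.
apply/eqP; rewrite eqn_leq; apply/andP; split; rewrite leqNgt; apply/negP => lt.
  have : a j < a i by apply: decr_a; rewrite iE jE.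
  have : b j < b i by apply: decr_b; rewrite iE jE.
  move=> lt_b lt_a; have eq_ij : i = j.
    by apply: (disj i j (a i)); rewrite /on_row; lia.
  by move: iE jE; rewrite eq_ij; lia.
(* Diagonal [a i - 1] lies between the ends [a l] and [b p - 1] of the hook, but rows up to [i]
   start after it and rows from [j] on end before it. *)
have [|||h /andP[]] := conv l p (a l) (a i).-1 (b p).-1; rewrite /on_row; try lia.
move=> le_ah lt_bh.
have : a h < a i by lia.
rewrite (decreasing_ltn _ _ decr_a) => lt_ih.
have : b h <= b j by apply: (decreasing_leq decr_b); lia.
lia.
Qed.

(** * Rim hooks obtained by moving one entry *)

Section Deletion.
Variables (a b : 'I_k.+1 -> nat) (p l : 'I_k.+1).
Hypotheses (decr_a : decreasing a) (decr_b : decreasing b).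
Hypothesis del : forall x : 'I_k, b (lift p x) = a (lift l x).
Hypothesis lt_alp : a l < b p.

(** Otherwise [b_l = a_(l+1) < a_l < b_p < b_l]. *)
Lemma deletion_leq : p <= l.
Proof.
rewrite leqNgt; apply/negP => lt_lp.
have lt_lk : l < k by have := ltn_ord p; lia.
have := del (Ordinal lt_lk).
have := decr_b lt_lp.
have -> : lift p (Ordinal lt_lk) = l by apply: val_inj; rewrite /= /bump; lia.
have : a (lift l (Ordinal lt_lk)) < a l by apply: decr_a; rewrite /= /bump; lia.
lia.
Qed.

Lemma deletion_out i : (i < p) || (l < i) -> b i = a i.
Proof.
have le_pl := deletion_leq => i_out.
have [lt_ip|le_pi] := ltnP i p.
  have lt_ik : i < k by have := ltn_ord p; lia.
  have := del (Ordinal lt_ik).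
  rewrite (_ : lift p _ = i) 1?(_ : lift l _ = i) //;
    by apply: val_inj; rewrite /= /bump; lia.
have lt_ik : i.-1 < k by have := ltn_ord i; lia.
have := del (Ordinal lt_ik).
by rewrite (_ : lift p _ = i) 1?(_ : lift l _ = i) //;
  apply: val_inj; rewrite /= /bump; lia.
Qed.

Lemma deletion_in i j : p <= i < l -> j = i.+1 :> nat -> b j = a i.
Proof.
move=> i_in jE.
have lt_ik : i < k by have := ltn_ord l; lia.
have := del (Ordinal lt_ik).
by rewrite (_ : lift p _ = j) 1?(_ : lift l _ = i) //;
  apply: val_inj; rewrite /= /bump; lia.
Qed.

Lemma deletion_row i : (a i < b i) = (p <= i <= l).
Proof.
have le_pl := deletion_leq; apply/idP/idP => [|/andP[le_pi le_il]].
  by apply: contraLR => i_out; rewrite deletion_out ?ltnn //; lia.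
have [lt_pi|le_ip] := ltnP p i.
  have lt_ik : i.-1 < k.+1 by have := ltn_ord i; lia.
  rewrite (@deletion_in (Ordinal lt_ik) i) /=; try lia.
  by apply: decr_a => /=; lia.
have {le_ip}-> : i = p by apply: val_inj; apply/eqP; rewrite eqn_leq le_ip.
have [lt_pl|le_lp] := ltnP p l; last first.
  by have {1}-> : p = l by apply: val_inj; apply/eqP; rewrite eqn_leq le_pl.
have lt_pk : p.+1 < k.+1 by have := ltn_ord l; lia.
rewrite -(@deletion_in p (Ordinal lt_pk)) ?leqnn //=.
exact: decr_b.
Qed.

Lemma deletion_le i : a i <= b i.
Proof.
case: (boolP (p <= i <= l)) => [|i_out]; first by rewrite -deletion_row => /ltnW.
by rewrite deletion_out //; lia.
Qed.

(** A lower row [j] of the hook ends at [b_j <= b_(i+1) = a_i], where row [i] begins. *)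
Lemma deletion_disjoint : disjoint_rows a b.
Proof.
move=> i j d; wlog lt_ij : i j / i < j => [hw|].
  case: (ltngtP i j) => [||/val_inj//]; first exact: hw.
  by move=> lt_ji di dj; apply/esym/hw.
rewrite /on_row => /andP[le_id lt_id] /andP[le_jd lt_jd].
have : p <= i <= l by rewrite -deletion_row; lia.
have : p <= j <= l by rewrite -deletion_row; lia.
move=> j_in i_in; have lt_ik : i.+1 < k.+1 by have := ltn_ord j; lia.
have := @deletion_in i (Ordinal lt_ik).
have : b j <= b (Ordinal lt_ik) by apply: decreasing_leq.
move=> le_b E; have : b (Ordinal lt_ik) = a i by apply: E => //; lia.
lia.
Qed.

(** Consecutive rows of the hook abut, so they tile the diagonals from [a_l] up to [b_p]; [e] lies
    in the first row that starts at or before it. *)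
Lemma deletion_convex : convex_rows a b.
Proof.
move=> i j d e f /andP[le_id lt_id] /andP[le_jf lt_jf] e_in.
have := deletion_row i; have := deletion_row j.
rewrite !(leq_ltn_trans _ lt_id, leq_ltn_trans _ lt_jf) // => /esym j_in /esym i_in.
have le_al : a l <= e.
  have : a l <= a i by apply: decreasing_leq => //; lia.
  lia.
have lt_bp : e < b p.
  have : b j <= b p by apply: decreasing_leq => //; lia.
  lia.
case: (arg_minnP (P := fun h => a h <= e) (@nat_of_ord _) le_al) => h le_ah h_min.
have le_hl := h_min _ le_al.
exists h; rewrite /on_row le_ah /=.
have [le_hp|lt_ph] := leqP h p; first by apply: leq_trans lt_bp _; apply: decreasing_leq.
have lt_hk : h.-1 < k.+1 by have := ltn_ord h; lia.
rewrite (@deletion_in (Ordinal lt_hk)) /=; try lia.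
rewrite ltnNge; apply/negP => /h_min /=; lia.
Qed.

End Deletion.

(** The rows where [a] and [b] differ are exactly those from [p] to [l]. *)
Lemma deletion_uniq a b p l p' l' : decreasing a -> decreasing b ->
  (forall x : 'I_k, b (lift p x) = a (lift l x)) -> a l < b p ->
  (forall x : 'I_k, b (lift p' x) = a (lift l' x)) -> a l' < b p' -> p = p' /\ l = l'.
Proof.
move=> decr_a decr_b del lt_alp del' lt_alp'.
have le_pl := deletion_leq decr_a decr_b del lt_alp.
have le_pl' := deletion_leq decr_a decr_b del' lt_alp'.
have E i : (p <= i <= l) = (p' <= i <= l').
  by rewrite -(deletion_row decr_a decr_b del) // (deletion_row decr_a decr_b del').
have := E p; have := E l; have := E p'; have := E l'.
by split; apply: val_inj => /=; lia.
Qed.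

End StrictlyDecreasing.

(** * Beta numbers of partitions in the box *)

Section BetaNumbers.
Variables k n : nat.
Implicit Types (lam mu nu : box_partition k n) (i j : 'I_k).

(** Column [c] of row [i] lies on diagonal [c + delta i], so this is also the first diagonal of row
    [i] beyond the diagram. *)
Definition beta lam i : nat := (lam i + delta i)%N.

Lemma sigma_beta lam : sigma lam = sym_class n (jacobi_trudi (beta lam)).
Proof. by rewrite /sigma schur_jacobi_trudi. Qed.

Lemma part_antitone lam i j : (i <= j)%N -> (lam j <= lam i)%N.
Proof. by case: lam => f /= /'forall_'forall_implyP; apply. Qed.

Lemma beta_decreasing lam : decreasing (beta lam).
Proof.
move=> i j lt_ij; have := part_antitone lam (ltnW lt_ij).
by have := ltn_ord j; rewrite /beta /delta; lia.
Qed.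

Lemma beta_bound lam i : (k <= n)%N -> (beta lam i < n)%N.
Proof.
by have := ltn_ord (lam i); have := ltn_ord i; rewrite /beta /delta; lia.
Qed.

Lemma beta_inj lam mu : beta lam =1 beta mu -> lam = mu.
Proof.
move=> E; apply/val_inj/ffunP => i; apply: val_inj.
exact: addIn (E i).
Qed.

(** Comparison with the last entry gives [b_i >= delta_i], and with the first, which is below [n],
    [b_i - delta_i <= n - k]; strict decrease makes the differences a partition. *)
Lemma beta_surj (b : 'I_k -> nat) : (k <= n)%N ->
  decreasing b -> (forall i, b i < n)%N -> exists mu, beta mu =1 b.
Proof.
move=> le_kn decr_b b_lt.
have ge_delta i : (delta i <= b i)%N.
  have lt_k : (k.-1 < k)%N by have := ltn_ord i; lia.
  have := @decreasing_gap _ b i (Ordinal lt_k) decr_b; rewrite /delta /=.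
  by have := ltn_ord i; lia.
have lt_part i : (b i - delta i < (n - k).+1)%N.
  have lt_0 : (0 < k)%N by have := ltn_ord i; lia.
  have := @decreasing_gap _ b (Ordinal lt_0) i decr_b; rewrite /delta /=.
  by have := ltn_ord i; have := b_lt (Ordinal lt_0); lia.
pose f := [ffun i => Ordinal (lt_part i)].
have f_anti : [forall i : 'I_k, forall j : 'I_k, (i <= j) ==> (f j <= f i)]%N.
  apply/'forall_'forall_implyP => i j le_ij; rewrite !ffunE /=.
  have := decreasing_gap decr_b le_ij; have := ge_delta i; have := ge_delta j.
  by have := ltn_ord j; rewrite /delta; lia.
by exists (BoxPartition f_anti) => i; rewrite /beta /= ffunE /= subnK.
Qed.

End BetaNumbers.

(** * Replacing one beta number and sorting *)

Section Insertion.
Variables k n : nat.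
Hypothesis le_kn : (k.+1 <= n)%N.
Implicit Types (lam mu nu : box_partition k.+1 n) (p l : 'I_k.+1).

(* [mu] arises from [lam] by changing the entry of [beta lam] in row [l] and moving
   it to row [p]. When the entry grows, the rim hook [mu / lam] occupies rows [p..l]. *)
Definition deletion lam l mu p : bool :=
  [forall x : 'I_k, beta mu (lift p x) == beta lam (lift l x)].

Lemma deletionP lam l mu p :
  reflect (forall x : 'I_k, beta mu (lift p x) = beta lam (lift l x))
          (deletion lam l mu p).
Proof. exact: 'forall_eqP. Qed.

Lemma lift_decreasing p (a : 'I_k.+1 -> nat) :
  decreasing a -> decreasing (fun x : 'I_k => a (lift p x)).
Proof. by move=> decr_a x y lt_xy; apply: decr_a; rewrite /= /bump; lia. Qed.

Lemma insertion_exists lam l v : (v < n)%N ->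
  (forall x : 'I_k, beta lam (lift l x) != v) ->
  exists mu p, deletion lam l mu p /\ beta mu p = v.
Proof.
move=> lt_vn v_new; pose a (x : 'I_k) := beta lam (lift l x).
have decr_a : decreasing a := lift_decreasing l (beta_decreasing lam).
(* The least such [m] is the number of remaining entries above [v], hence the slot for [v]. *)
pose P m := [forall x : 'I_k, (m <= x)%N ==> (a x < v)%N].
have exP : exists m, P m.
  by exists k; apply/forallP => x; rewrite leqNgt ltn_ord.
case: (ex_minnP exP) => m /'forall_implyP Pm m_min.
have lt_mk : (m < k.+1)%N.
  by rewrite ltnS m_min //; apply/forallP => x; rewrite leqNgt ltn_ord.
pose p := Ordinal lt_mk.
have gt_v (x : 'I_k) : (x < m)%N -> (v < a x)%N.
  move=> lt_xm; have : ~~ P x by apply: contraL lt_xm => /m_min; rewrite -leqNgt.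
  rewrite negb_forall => /existsP[y]; rewrite negb_imply -leqNgt => /andP[le_xy le_vay].
  rewrite ltn_neqAle eq_sym v_new /= (leq_trans le_vay) //.
  exact: decreasing_leq.
pose b i := if unlift p i is Some x then a x else v.
have bp : b p = v by rewrite /b unlift_none.
have bl x : b (lift p x) = a x by rewrite /b liftK.
have decr_b : decreasing b.
  move=> i j; case: (unliftP p i) => [x|] ->; case: (unliftP p j) => [y|] ->;
    rewrite ?bp ?bl ?ltnn //= /bump => lt.
  - by apply: decr_a; lia.
  - by apply: gt_v; lia.
  by apply: Pm; lia.
have [|mu muE] := beta_surj le_kn decr_b.
  move=> i; case: (unliftP p i) => [x|] ->; rewrite ?bp // bl.
  exact: beta_bound.
by exists mu, p; split; [apply/deletionP => x|]; rewrite muE ?bp ?bl.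
Qed.

(** The slot is the number of remaining entries above the inserted value, so that value determines
    it. *)
Lemma insertion_uniq lam l mu p mu' p' :
  deletion lam l mu p -> deletion lam l mu' p' -> beta mu p = beta mu' p' ->
  mu = mu' /\ p = p'.
Proof.
move=> /deletionP del /deletionP del' E.
have pos (x : 'I_k) : (x < p)%N = (x < p')%N.
  have -> : (x < p)%N = (lift p x < p)%N by rewrite /= /bump; lia.
  have -> : (x < p')%N = (lift p' x < p')%N by rewrite /= /bump; lia.
  rewrite -(decreasing_ltn _ _ (beta_decreasing mu)).
  by rewrite -(decreasing_ltn _ _ (beta_decreasing mu')) del del' E.
have eq_p : p = p'.
  apply/val_inj => /=; case: (ltngtP p p') => // lt.
    have lt_pk : (p < k)%N by have := ltn_ord p'; lia.
    by have := pos (Ordinal lt_pk); rewrite /= lt ltnn.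
  have lt_pk : (p' < k)%N by have := ltn_ord p; lia.
  by have := pos (Ordinal lt_pk); rewrite /= lt ltnn.
split=> //; apply: beta_inj => i.
by case: (unliftP p i) => [x|] ->; rewrite ?del ?E eq_p ?del'.
Qed.

(** The right side has at most one term. If another row already has the entry [v], both sides
    vanish; otherwise [v] is sorted into a unique slot. Summing over all [mu] prepares a later
    exchange of sums. *)
Lemma jacobi_trudi_replace lam l v : (v < n)%N ->
  sym_class n (jacobi_trudi (replace (beta lam) l v)) =
  \sum_mu \sum_(p | deletion lam l mu p && (beta mu p == v))
    (-1) ^+ (p + l) * sigma mu.
Proof.
move=> lt_vn; rewrite pair_big_dep /=.
case: (pickP (fun x => beta lam (lift l x) == v)) => [x /eqP xv|nv].
  rewrite (@jacobi_trudi_eq0 _ _ l (lift l x)) ?neq_lift //; last first.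
    by rewrite /replace eqxx eq_sym (negbTE (neq_lift _ _)).
  rewrite rmorph0 big1 // => -[mu p] /= /andP[/deletionP del /eqP pv].
  have : lift p x != p by rewrite eq_sym neq_lift.
  by case/eqP; apply: (decreasing_inj (beta_decreasing mu)); rewrite del xv.
have [x|mu [p [del pv]]] := @insertion_exists lam l v lt_vn; first by rewrite nv.
rewrite (big_pred1 (mu, p)) /= => [|[mu' p'] /=].
  rewrite sigma_beta.
  (* [lift_perm l p 1] sends [l] to [p] and keeps the other rows in order: a cycle of sign
     [(-1)^(p + l)]. *)
  rewrite (@eq_jacobi_trudi _ _ (fun i => beta mu (lift_perm l p 1%g i))).
    rewrite jacobi_trudi_perm rmorphM rmorph_sign; congr (_ * _).
    by rewrite odd_lift_perm odd_perm1 addbF addbC -[RHS]signr_odd oddD.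
  move=> i; case: (unliftP l i) => [x|] ->.
    rewrite lift_perm_lift perm1 (deletionP _ _ _ _ del) /replace.
    by rewrite eq_sym (negbTE (neq_lift _ _)).
  by rewrite lift_perm_id /replace eqxx pv.
apply/andP/eqP => [[del' /eqP pv']|[-> ->]]; last by rewrite del pv.
by have [|-> ->] := insertion_uniq del' del; rewrite ?pv'.
Qed.

End Insertion.

(** * Rim hooks in terms of beta numbers *)

Section RimHooks.
Variables k n : nat.
Implicit Types (lam mu nu : box_partition k n) (i : 'I_k).

Lemma mem_skew_shape mu lam i (c : 'I_(n - k)) :
  ((i, c) \in skew_shape mu lam) = (lam i <= c < mu i)%N.
Proof. by rewrite !inE -leqNgt. Qed.

Lemma card_skew_shape mu lam :
  #|skew_shape mu lam| = (\sum_i (mu i - lam i))%N.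
Proof.
rewrite -sum1_card (eq_bigl (fun b : 'I_k * 'I_(n - k) =>
  true && (lam b.1 <= b.2 < mu b.1)%N)); last first.
  by case=> i c; rewrite mem_skew_shape.
rewrite -(pair_big_dep xpredT (fun i (c : 'I_(n - k)) => (lam i <= c < mu i)%N)
  (fun _ _ => 1%N)).
apply: eq_bigr => i _; rewrite sum1_card -(@card_ord_interval (n - k) (lam i) (mu i)).
  by rewrite cardsE.
by rewrite -ltnS ltn_ord.
Qed.

Lemma on_row_box mu lam i d : on_row (beta lam) (beta mu) i d ->
  exists2 b, b \in skew_shape mu lam & b.1 = i /\ diagonal b = d.
Proof.
rewrite /on_row /beta /delta => /andP[le_d lt_d].
have lt_c : (d - delta i < n - k)%N.
  by have := ltn_ord (mu i); rewrite /delta; lia.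
exists (i, Ordinal lt_c); last by split; rewrite // /diagonal /= /delta; lia.
by rewrite mem_skew_shape /= /delta; lia.
Qed.

Lemma box_on_row mu lam b :
  b \in skew_shape mu lam -> on_row (beta lam) (beta mu) b.1 (diagonal b).
Proof.
case: b => i c; rewrite mem_skew_shape /on_row /beta /delta /diagonal /=; lia.
Qed.

Lemma row_nonempty mu lam :
  [set b.1 | b in skew_shape mu lam] = [set i | beta lam i < beta mu i]%N.
Proof.
apply/setP => i; rewrite inE; apply/imsetP/idP => [[b /box_on_row b_row ->]|lt].
  by move: b_row => /andP[]; exact: leq_ltn_trans.
have [|b b_in [<- _]] := @on_row_box mu lam i (beta lam i); last by exists b.
by rewrite /on_row leqnn.
Qed.

Lemma rim_hookP mu lam : (k <= n)%N ->
  reflect [/\ forall i, (beta lam i <= beta mu i)%N,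
              exists i, (beta lam i < beta mu i)%N,
              disjoint_rows (beta lam) (beta mu)
            & convex_rows (beta lam) (beta mu)]
          (is_rim_hook mu lam).
Proof.
move=> le_kn; apply: (iffP and4P) => [[le_lm nz disj conv]|[le_lm [i lt_i] disj conv]].
  split.
  - by move=> i; rewrite leq_add2r; exact: (forallP le_lm).
  - case/set0Pn: nz => b /box_on_row/andP[le_d lt_d]; exists b.1.
    exact: leq_ltn_trans lt_d.
  - move=> i j d /on_row_box[b b_in [<- bd]] /on_row_box[b' b'_in [<- b'd]].
    have /forall_inP/(_ _ b_in)/forall_inP/(_ _ b'_in) := disj.
    by rewrite bd b'd eqxx => /eqP ->.
  move=> i j d e f di fj /andP[le_de le_ef].
  (* Diagonals range over ['I_n] in [is_rim_hook]; [e] qualifies because beta numbers are below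
     [n]. *)
  have lt_en : (e < n)%N.
    apply: leq_ltn_trans le_ef _; case/andP: fj => _ /ltn_trans; apply.
    exact: beta_bound.
  have [b b_in [_ bd]] := on_row_box di; have [b' b'_in [_ b'f]] := on_row_box fj.
  have /forall_inP/(_ _ b_in)/forall_inP/(_ _ b'_in)/forallP/(_ (Ordinal lt_en)) := conv.
  rewrite bd b'f le_de le_ef => /exists_inP[b'' b''_in /eqP b''e].
  by exists b''.1; rewrite -[e]b''e; apply: box_on_row.
split.
- by apply/forallP => j; have := le_lm j; rewrite leq_add2r.
- have [|b b_in _] := @on_row_box mu lam i (beta lam i); first by rewrite /on_row leqnn.
  by apply/set0Pn; exists b.
- apply/forall_inP => -[r c] b_in; apply/forall_inP => -[r' c'] b'_in.
  apply/implyP => /eqP E; have /= := box_on_row b'_in; rewrite -E => row'.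
  have /= eq_r := disj _ _ _ (box_on_row b_in) row'; move: E; rewrite eq_r /diagonal /=.
  by move/addIn/val_inj->.
apply/forall_inP => b b_in; apply/forall_inP => b' b'_in.
apply/forallP => d; apply/implyP => d_in; apply/exists_inP.
have [h /on_row_box[b'' b''_in [_ b''d]]] :=
  conv _ _ _ _ _ (box_on_row b_in) (box_on_row b'_in) d_in.
by exists b''; rewrite ?b''d.
Qed.

End RimHooks.

(** * Rim hooks as moves of one beta number *)

Section Deletions.
Variables k n : nat.
Hypothesis le_kn : (k.+1 <= n)%N.
Implicit Types (lam mu nu : box_partition k.+1 n) (p l : 'I_k.+1).

Lemma sum_deletion lam mu p l : deletion lam l mu p ->
  (\sum_i beta mu i + beta lam l = \sum_i beta lam i + beta mu p)%N.
Proof.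
move=> /deletionP del; rewrite (bigD1_ord p) //= [in RHS](bigD1_ord l) //=.
under eq_bigr do rewrite del; lia.
Qed.

Lemma card_skew_shape_beta lam mu : (forall i, (beta lam i <= beta mu i)%N) ->
  (#|skew_shape mu lam| = \sum_i beta mu i - \sum_i beta lam i)%N.
Proof.
move=> le_beta; rewrite card_skew_shape -sumnB //; apply: eq_bigr => i _.
by rewrite /beta subnDr.
Qed.

(** [hook_delete] provides the rows; comparing the totals of the beta numbers shows that the moved
    entry grows by the size of the hook. *)
Lemma rim_hook_deletion lam mu t : (0 < t)%N ->
  is_rim_hook mu lam -> #|skew_shape mu lam| = t ->
  exists p l, deletion lam l mu p /\ beta mu p = (beta lam l + t)%N.
Proof.
move=> t_gt0 /(rim_hookP _ _ le_kn)[le_beta ne disj conv].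
rewrite card_skew_shape_beta // => tE.
have [p [l del]] := hook_delete (beta_decreasing lam) (beta_decreasing mu)
  le_beta ne disj conv.
exists p, l; split; first exact/deletionP.
have /sum_deletion : deletion lam l mu p by exact/deletionP.
have : (\sum_i beta lam i <= \sum_i beta mu i)%N by apply: leq_sum => i _.
lia.
Qed.

Lemma deletion_rim_hook lam mu t p l : (0 < t)%N ->
  deletion lam l mu p -> beta mu p = (beta lam l + t)%N ->
  [/\ is_rim_hook mu lam, #|skew_shape mu lam| = t
    & odd (height mu lam + 1) = odd (p + l)].
Proof.
move=> t_gt0 delb pt; have /deletionP del := delb.
have lt_beta : (beta lam l < beta mu p)%N by rewrite pt; lia.
have [decr_l decr_m] := (beta_decreasing lam, beta_decreasing mu).
have le_beta := deletion_le decr_l decr_m del lt_beta.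
have row := deletion_row decr_l decr_m del lt_beta.
have le_pl := deletion_leq decr_l decr_m del lt_beta.
split.
- apply/rim_hookP => //; split=> //; first by exists p; rewrite row leqnn.
    exact: deletion_disjoint del lt_beta.
  exact: deletion_convex del lt_beta.
- rewrite card_skew_shape_beta //; have := sum_deletion delb.
  have : (\sum_i beta lam i <= \sum_i beta mu i)%N by apply: leq_sum => i _.
  lia.
(* The hook meets the [l - p + 1] rows from [p] to [l], so its height plus one has the parity of
   [p + l]. *)
rewrite /height row_nonempty (_ : [set _ | _] = [set i : 'I_k.+1 | p <= i < l.+1]%N).
  rewrite card_ord_interval ?ltn_ord // addn1 subSn //= negbK.
  by rewrite oddB // oddD addbC.
by apply/setP => i; rewrite !inE row ltnS.
Qed.

(** At most one pair [(l, p)] contributes, by [deletion_uniq], and one does exactly when [mu / lam]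
    is a rim hook of size [t]. *)
Lemma sum_deletions lam mu t (x : qH k.+1 n) : (0 < t)%N ->
  \sum_l \sum_(p | deletion lam l mu p && (beta mu p == beta lam l + t)%N)
     (-1) ^+ (p + l) * x =
  if is_rim_hook mu lam && (#|skew_shape mu lam| == t)
  then (-1) ^+ (height mu lam + 1) * x else 0.
Proof.
move=> t_gt0; rewrite pair_big_dep /=.
case: ifP => [/andP[hook /eqP card]|no_hook]; last first.
  apply: big1 => -[l p] /= /andP[del /eqP pt].
  by have [hook card _] := deletion_rim_hook t_gt0 del pt;
    rewrite hook card eqxx in no_hook.
have [p [l [del pt]]] := rim_hook_deletion t_gt0 hook card.
have [_ _ sgn] := deletion_rim_hook t_gt0 del pt.
rewrite (big_pred1 (l, p)) => [|[l' p'] /=].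
  by rewrite -signr_odd -sgn signr_odd.
apply/andP/eqP => [[/deletionP del' /eqP pt']|[-> ->]]; last by rewrite del pt.
have [||||||-> -> //] := @deletion_uniq k (beta lam) (beta mu) p' l' p l.
- exact: beta_decreasing.
- exact: beta_decreasing.
- exact: del'.
- by rewrite pt'; lia.
- exact/deletionP.
by rewrite pt; lia.
Qed.

End Deletions.

(** * The quantum Murnaghan-Nakayama rule *)

Theorem theorem2 (k r n : nat) (k_gt0 : (0 < k)%N) (r_gt0 : (0 < r)%N)
    (k_lt_n : (k < n)%N) (r_lt_n : (r < n)%N) (lam : box_partition k n) :
  quantum_power_sum k n r * sigma lam =
    \sum_(mu : box_partition k n | is_rim_hook mu lam && (#|skew_shape mu lam| == r))
        (-1) ^+ (height mu lam + 1) * sigma mu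
    - (-1) ^+ k * quantum_param k n *
      \sum_(nu : box_partition k n |
              is_rim_hook lam nu && (#|skew_shape lam nu| == n - r)%N)
          (-1) ^+ (height lam nu + 1) * sigma nu.
Proof.
case: k k_gt0 k_lt_n lam => // k _ k_lt_n lam; have le_kn := ltnW k_lt_n.
rewrite sigma_beta /quantum_power_sum -[qH_class _ _ _]/(sym_class n (power_sum k.+1 r)).
rewrite -rmorphM power_sum_jacobi_trudi rmorph_sum.
(* Exponents still below [n] after raising give the classical sum; the others are reduced and give
   the quantum sum. *)
rewrite (bigID (fun l => beta lam l + r < n)%N) /= -mulNr; congr (_ + _).
  rewrite [RHS]big_mkcond /=.
  under [RHS]eq_bigr do rewrite -(sum_deletions le_kn lam _ _ r_gt0).
  rewrite exchange_big big_mkcond /=; apply: eq_bigr => l _.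
  case: ifPn => [lt_n|ge_n]; first exact: jacobi_trudi_replace.
  (* A raised entry that reached [n] is no beta number of a partition in the box. *)
  rewrite big1 // => mu _; rewrite big1 // => p /andP[_ /eqP pE].
  by rewrite -pE beta_bound in ge_n.
have nr_gt0 : (0 < n - r)%N by rewrite subn_gt0.
rewrite mulr_sumr [RHS]big_mkcond /=.
(* Raising by [r] and lowering by [n] lowers entry [p] of [lam] by [n - r]; read backwards, [lam]
   arises from [nu] by raising an entry by [n - r]. *)
transitivity (\sum_p - ((-1) ^+ k.+1 * quantum_param k.+1 n) * \sum_nu
    \sum_(l | deletion nu l lam p && (beta lam p == beta nu l + (n - r))%N)
       (-1) ^+ (p + l) * sigma nu).
  rewrite big_mkcond /=; apply: eq_bigr => p _; case: ifPn => [|lt_n]; last first.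
    (* Here [beta lam p < n - r], so no entry of [nu] raised by [n - r] can equal it. *)
    rewrite big1 ?mulr0 // => nu _; rewrite big1 // => l /andP[_ /eqP pE].
    by case/negP: lt_n; rewrite pE; lia.
  rewrite -leqNgt => ge_n.
  have -> : (beta lam p + r = (beta lam p + r - n) + n)%N by rewrite subnK.
  rewrite jacobi_trudi_quantum_reduction 1?ltnW // jacobi_trudi_replace //; last first.
    by have := beta_bound lam p le_kn; lia.
  congr (_ * _); apply: eq_bigr => nu _; apply: eq_big => [l|l _]; last by rewrite addnC.
  congr (_ && _); last by apply/eqP/eqP; lia.
  by apply: eq_forallb => x; rewrite eq_sym.
rewrite -mulr_sumr exchange_big mulr_sumr; apply: eq_bigr => nu _.
rewrite (exchange_big_dep xpredT) //= (sum_deletions le_kn nu _ _ nr_gt0).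
by case: ifP; rewrite ?mulr0.
Qed.
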